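(* Let $t\ge2$ and let $>$ be the graded reverse lexicographic order on $\mathbb{K}[E_t]$ with $a_1>\cdots>a_t>f_1>f_2>f_3>e_1>e_2>e_3>b_1>\cdots>b_t$. Order the minimal monomial generators of $\operatorname{in}(I_{G_t})$ as follows: first the elements of $\mathcal{M}_1=\{a_ib_j:1\le j<i\le t\}$, then those of $\mathcal{M}_2=\{a_ia_jf_1f_3e_2:1\le i<j\le t\}$, then those of $\mathcal{M}_3=\{a_i^2f_1f_3e_2:1\le i\le t\}$, each set listed from smallest to largest with respect to $>$; explicitly $a_tb_{t-1}, a_tb_{t-2},\dots,a_{t-1}b_{t-2},\dots,a_2b_1,\ a_ta_{t-1}f_1f_3e_2, a_ta_{t-2}f_1f_3e_2,\dots,a_2a_1f_1f_3e_2,\ a_t^2f_1f_3e_2, a_{t-1}^2f_1f_3e_2,\dots,a_1^2f_1f_3e_2$. Then $\operatorname{in}(I_{G_t})$ has linear quotients with respect to this ordering $g_1,\dots,g_{t^2}$. Furthermore, if $n_p$ denotes the number of (variable) generators of $\langle g_1,\dots,g_{p-1}\rangle:\langle g_p\rangle$, then $\max\{n_p : 2\le p\le t^2\}=2t-2$.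
   Context: $\mathbb{K}$ is an algebraically closed field of characteristic zero. For $t\ge2$, $G_t$ is the graph with vertex set $\{x_1,x_2,y_1,\dots,y_t,z_1,z_2,w_1,w_2\}$ and edges $a_i=\{x_1,y_i\}$, $b_i=\{x_2,y_i\}$ ($1\le i\le t$), $e_1=\{x_1,z_1\}$, $e_2=\{z_1,z_2\}$, $e_3=\{z_2,x_1\}$, $f_1=\{x_2,w_1\}$, $f_2=\{w_1,w_2\}$, $f_3=\{w_2,x_2\}$. Its toric ideal $I_{G_t}$ is the kernel of the $\mathbb{K}$-algebra map from $\mathbb{K}[E_t]=\mathbb{K}[a_1,\dots,a_t,f_1,f_2,f_3,e_1,e_2,e_3,b_1,\dots,b_t]$ to the polynomial ring on the vertices sending each edge variable to the product of its two endpoints; $\operatorname{in}(I_{G_t})$ is its initial ideal with respect to $>$. A monomial ideal has linear quotients with respect to an ordering $g_1,\dots,g_m$ of its minimal generators if $\langle g_1,\dots,g_{j-1}\rangle:\langle g_j\rangle$ is generated by variables for every $j=2,\dots,m$.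
   Formalization: The order within M_1 follows the displayed list in blocks (i decreasing, then j decreasing); for t ≥ 4 this is not smallest to largest for > (a_4b_1 precedes a_3b_2 although a_3b_2 < a_4b_1 when t = 4), so the two descriptions of the order in the statement conflict. *)

(* Defs.v *)
From HB Require Import structures.
From mathcomp Require Import all_boot all_order all_algebra.
From mathcomp Require Import mpoly.
Set Implicit Arguments. Unset Strict Implicit. Unset Printing Implicit Defensive.
Import Order.TTheory GRing.Theory.
Local Open Scope ring_scope.

Definition ideal_gen (n : nat) (R : comNzRingType) (S : {mpoly R[n]} -> Prop)
  (p : {mpoly R[n]}) : Prop :=
  exists (k : nat) (c g : 'I_k -> {mpoly R[n]}),
    (forall i, S (g i)) /\ p = \sum_(i < k) c i * g i.

(* Graded reverse lexicographic order, where variable index 0 is the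
   largest variable and index n-1 the smallest:  m <= m'  iff
   deg m < deg m', or deg m = deg m' and either m = m' or, at the last
   (largest-index) coordinate k where they differ, m k > m' k. *)
Definition grevlex_le (n : nat) (m m' : 'X_{1..n}) : Prop :=
  (mdeg m < mdeg m')%N \/
  (mdeg m = mdeg m' /\
   (m = m' \/ exists k : 'I_n, (m' k < m k)%N /\
                               forall l : 'I_n, (k < l)%N -> m l = m' l)).

Definition is_lead_mon (n : nat) (R : comNzRingType) (p : {mpoly R[n]})
  (m : 'X_{1..n}) : Prop :=
  m \in msupp p /\ forall m', m' \in msupp p -> grevlex_le m' m.

Definition initial_ideal (n : nat) (R : comNzRingType) (I : {mpoly R[n]} -> Prop)
  : {mpoly R[n]} -> Prop :=
  ideal_gen (fun q => exists (f : {mpoly R[n]}) (m : 'X_{1..n}),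
                 [/\ I f, f != 0, is_lead_mon f m & q = 'X_[m]]).

Definition mdivides (n : nat) (m m' : 'X_{1..n}) : Prop :=
  forall k : 'I_n, (m k <= m' k)%N.

Definition min_mon_gen (n : nat) (R : comNzRingType) (J : {mpoly R[n]} -> Prop)
  (m : 'X_{1..n}) : Prop :=
  J 'X_[m] /\ forall m', mdivides m' m -> m' <> m -> ~ J 'X_[m'].

Definition colon_prefix (n : nat) (R : comNzRingType) (gs : seq 'X_{1..n})
  (j : nat) (p : {mpoly R[n]}) : Prop :=
  ideal_gen (fun q => exists2 i, (i < j)%N & q = 'X_[nth 0%MM gs i])
            (p * 'X_[nth 0%MM gs j]).

Definition colon_gen_by_vars (n : nat) (R : comNzRingType) (gs : seq 'X_{1..n})
  (j : nat) (S : {set 'I_n}) : Prop :=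
  forall p : {mpoly R[n]},
    colon_prefix gs j p <-> ideal_gen (fun q => exists2 k, k \in S & q = 'X_k) p.

Definition linear_quotients (n : nat) (R : comNzRingType) (gs : seq 'X_{1..n})
  : Prop :=
  forall j, (0 < j < size gs)%N -> exists S : {set 'I_n}, colon_gen_by_vars R gs j S.

(* Edge variables: 2t+6, ordered a_1..a_t, f1,f2,f3, e1,e2,e3, b_1..b_t
   (index 0 = a_1 is the largest variable). *)
Definition nE (t : nat) : nat := (2 * t + 5).+1.
(* Vertices: x1, x2, y_1..y_t, z1, z2, w1, w2. *)
Definition nV (t : nat) : nat := (t + 5).+1.

Definition va (t i : nat) : 'I_(nE t) := inord i.-1.      (* a_i, 1<=i<=t *)
Definition vf1 (t : nat) : 'I_(nE t) := inord t.
Definition vf2 (t : nat) : 'I_(nE t) := inord (t + 1).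
Definition vf3 (t : nat) : 'I_(nE t) := inord (t + 2).
Definition ve1 (t : nat) : 'I_(nE t) := inord (t + 3).
Definition ve2 (t : nat) : 'I_(nE t) := inord (t + 4).
Definition ve3 (t : nat) : 'I_(nE t) := inord (t + 5).
Definition vb (t j : nat) : 'I_(nE t) := inord (t + 5 + j). (* b_j, 1<=j<=t *)

Definition vx1 (t : nat) : 'I_(nV t) := inord 0.
Definition vx2 (t : nat) : 'I_(nV t) := inord 1.
Definition vy (t i : nat) : 'I_(nV t) := inord (i.+1).   (* y_i, 1<=i<=t *)
Definition vz1 (t : nat) : 'I_(nV t) := inord (t + 2).
Definition vz2 (t : nat) : 'I_(nV t) := inord (t + 3).
Definition vw1 (t : nat) : 'I_(nV t) := inord (t + 4).
Definition vw2 (t : nat) : 'I_(nV t) := inord (t + 5).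

Definition edge_ends (t : nat) (k : 'I_(nE t)) : 'I_(nV t) * 'I_(nV t) :=
  if (k < t)%N then (vx1 t, vy t k.+1)                  (* a_i = {x1,y_i} *)
  else if k == t :> nat then (vx2 t, vw1 t)             (* f1 = {x2,w1} *)
  else if k == t + 1 :> nat then (vw1 t, vw2 t)         (* f2 = {w1,w2} *)
  else if k == t + 2 :> nat then (vw2 t, vx2 t)         (* f3 = {w2,x2} *)
  else if k == t + 3 :> nat then (vx1 t, vz1 t)         (* e1 = {x1,z1} *)
  else if k == t + 4 :> nat then (vz1 t, vz2 t)         (* e2 = {z1,z2} *)
  else if k == t + 5 :> nat then (vz2 t, vx1 t)         (* e3 = {z2,x1} *)
  else (vx2 t, vy t (k - (t + 5))).                     (* b_j = {x2,y_j} *)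

Definition toric_map (K : comNzRingType) (t : nat) (p : {mpoly K[nE t]})
  : {mpoly K[nV t]} :=
  mmap (fun c : K => c%:MP) (fun k => 'X_(edge_ends k).1 * 'X_(edge_ends k).2) p.

Definition toric_ideal (K : comNzRingType) (t : nat) (p : {mpoly K[nE t]}) : Prop :=
  toric_map p = 0.

Definition mU (t : nat) (k : 'I_(nE t)) : 'X_{1..nE t} := mnm1 k.
Definition madd (t : nat) (m m' : 'X_{1..nE t}) : 'X_{1..nE t} := mnm_add m m'.

Definition mF (t : nat) : 'X_{1..nE t} :=
  madd (madd (mU (vf1 t)) (mU (vf3 t))) (mU (ve2 t)).

Definition gM1 (t : nat) : seq 'X_{1..nE t} :=
  flatten [seq [seq madd (mU (va t i)) (mU (vb t j)) | j <- rev (iota 1 i.-1)]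
          | i <- rev (iota 2 t.-1)].
Definition gM2 (t : nat) : seq 'X_{1..nE t} :=
  flatten [seq [seq madd (madd (mU (va t i)) (mU (va t j))) (mF t)
               | j <- rev (iota 1 i.-1)]
          | i <- rev (iota 2 t.-1)].
Definition gM3 (t : nat) : seq 'X_{1..nE t} :=
  [seq madd (madd (mU (va t i)) (mU (va t i))) (mF t) | i <- rev (iota 1 t)].

Definition gens (t : nat) : seq 'X_{1..nE t} := gM1 t ++ gM2 t ++ gM3 t.

(* Main.v *)
Require Import Defs.
From HB Require Import structures.
From mathcomp Require Import all_boot all_order all_algebra.
From mathcomp Require Import mpoly.
From mathcomp Require Import zify.
Set Implicit Arguments. Unset Strict Implicit.
Import GRing.Theory.
Local Open Scope ring_scope.

(* Every leading term m of an element of the toric ideal is accompanied by a smaller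
   monomial m' with the same image, since the images have to cancel. Comparing vertex
   degrees shows that m is then divisible by one of the listed monomials, and each of
   these is the leading term of a binomial of the ideal; as no one divides another,
   they are the minimal generators of the initial ideal. Membership in the colon
   ideals is decided monomial by monomial: whenever g_i with i < j divides g_j m,
   some variable x dividing m satisfies g_i' | g_j x for some i' < j, so the colon
   ideal is generated by the variables it contains. These are never among
   e_1, e_2, e_3, f_1, f_2, f_3, b_t and the top a_i of g_j, and for g_j =
   a_t^2 f_1 f_3 e_2 all the 2t - 2 others occur. *)

(** * Monomial ideals and their colon ideals, tested on monomials *)

(** All terms of a multiple of ['X_[m']] are divisible by [m']; conversely [p] is the sum of its
    terms, each a multiple of the generator chosen for it. *)
Lemma ideal_gen_msupp (n : nat) (R : comNzRingType) (S : {mpoly R[n]} -> Prop)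
    (T : 'X_{1..n} -> Prop) (p : {mpoly R[n]}) :
  (forall q, S q <-> exists2 m, T m & q = 'X_[m]) ->
  ideal_gen S p <->
  forall m, m \in msupp p -> exists2 m', T m' & mdivides m' m.
Proof.
move=> ST; split=> [[k [c [g [Sg ->]]]] m | H].
  rewrite mcoeff_msupp raddf_sum /= => nz.
  have [i] : exists i, (c i * g i)@_m != 0.
    apply/existsP; apply: contraNT nz => /existsPn H.
    by rewrite big1 // => i _; apply/eqP; move: (H i); rewrite negbK.
  have [m' Tm' ->] := (ST (g i)).1 (Sg i).
  rewrite -mcoeff_msupp (perm_mem (msuppMX _ _)) => /mapP[m2 _ ->].
  by exists m' => // l; rewrite mnmDE leq_addr.
have /fin_all_exists[f Hf] : forall i : 'I_(size (msupp p)), exists m',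
    T m' /\ mdivides m' (nth 0%MM (msupp p) i).
  by move=> i; have [m' ? ?] := H _ (mem_nth 0%MM (ltn_ord i)); exists m'.
exists (size (msupp p)).
exists (fun i : 'I_(size (msupp p)) =>
  p@_(nth 0%MM (msupp p) i) *: 'X_[nth 0%MM (msupp p) i - f i]).
exists (fun i => 'X_[f i]); split=> [i|].
  by apply/ST; exists (f i) => //; case: (Hf i).
rewrite {1}[p]mpolyE (big_nth 0%MM) big_mkord; apply: eq_bigr => i _.
by rewrite -scalerAl -mpolyXD submK //; apply/mnm_lepP; case: (Hf i).
Qed.

Definition in_colon (n : nat) (gs : seq 'X_{1..n}) (j : nat) (m : 'X_{1..n}) :=
  exists2 i, (i < j)%N & mdivides (nth 0%MM gs i) (nth 0%MM gs j + m)%MM.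

Lemma colon_prefix_msupp (n : nat) (R : comNzRingType) (gs : seq 'X_{1..n})
    (j : nat) (p : {mpoly R[n]}) :
  colon_prefix gs j p <-> forall m, m \in msupp p -> in_colon gs j m.
Proof.
pose T m := exists2 i, (i < j)%N & m = nth 0%MM gs i.
have E := ideal_gen_msupp (T := T) (p * 'X_[nth 0%MM gs j]).
apply: iff_trans (E _ _) _ => [q | ].
  split=> [[i ij ->]|[m [i ij ->] ->]]; last by exists i.
  by exists (nth 0%MM gs i) => //; exists i.
split=> H m.
  move=> mp; case: (H (nth 0%MM gs j + m)%MM); last first.
    by move=> _ [i ij ->] dv; exists i.
  by rewrite (perm_mem (msuppMX _ _)) map_f.
rewrite (perm_mem (msuppMX _ _)) => /mapP[m1 /H[i ij dv] ->].
by exists (nth 0%MM gs i) => //; exists i.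
Qed.

Lemma ideal_vars_msupp (n : nat) (R : comNzRingType) (S : {set 'I_n})
    (p : {mpoly R[n]}) :
  ideal_gen (fun q => exists2 k, k \in S & q = 'X_k) p <->
  forall m, m \in msupp p -> exists2 k, k \in S & (0 < m k)%N.
Proof.
pose T m := exists2 k, k \in S & m = U_(k)%MM.
apply: iff_trans (ideal_gen_msupp (T := T) p _) _ => [q | ].
  split=> [[k kS ->]|[m [k kS ->] ->]]; last by exists k.
  by exists U_(k)%MM => //; exists k.
split=> H m /H [].
  by move=> _ [k kS ->] /(_ k); rewrite mnm1E eqxx => ?; exists k.
move=> k kS mk; exists U_(k)%MM; first by exists k.
by move=> l; rewrite mnm1E; case: eqP => // <-.
Qed.

(** Both ideals are monomial, so they agree as soon as they agree on each ['X_[m]]. The coefficient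
    ring disappears from the condition. *)
Lemma colon_gen_by_varsE (n : nat) (R : comNzRingType) (gs : seq 'X_{1..n})
    (j : nat) (S : {set 'I_n}) :
  colon_gen_by_vars R gs j S <->
  forall m, in_colon gs j m <-> exists2 k, k \in S & (0 < m k)%N.
Proof.
split=> H.
  move=> m; have := H 'X_[m]; rewrite colon_prefix_msupp ideal_vars_msupp.
  rewrite msuppX => -[H1 H2]; split=> [Hm|Hm].
    by apply: H1; rewrite ?mem_head // => m'; rewrite inE => /eqP->.
  by apply: H2; rewrite ?mem_head // => m'; rewrite inE => /eqP->.
move=> p; rewrite colon_prefix_msupp ideal_vars_msupp.
by split=> Hp m /Hp /H.
Qed.

(** A variable in an ideal generated by variables is one of them. Hence the colon ideal determines
    [S], and [#|S|] is a well-defined number of generators. *)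
Lemma colon_gen_by_vars_mem (n : nat) (R : comNzRingType) (gs : seq 'X_{1..n})
    (j : nat) (S : {set 'I_n}) (k : 'I_n) :
  colon_gen_by_vars R gs j S -> k \in S <-> in_colon gs j U_(k)%MM.
Proof.
move=> /colon_gen_by_varsE H; rewrite H; split=> [kS|[l lS]].
  by exists k => //; rewrite mnm1E eqxx.
by rewrite mnm1E; case: eqP => // ->.
Qed.

Lemma mdivides_trans (n : nat) (m1 m2 m3 : 'X_{1..n}) :
  mdivides m1 m2 -> mdivides m2 m3 -> mdivides m1 m3.
Proof. by move=> H1 H2 k; apply: leq_trans (H1 k) (H2 k). Qed.

Lemma min_mon_gen_antichain (n : nat) (R : comNzRingType)
    (J : {mpoly R[n]} -> Prop) (gs : seq 'X_{1..n}) (m : 'X_{1..n}) :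
  (forall m, J 'X_[m] <-> exists2 g, g \in gs & mdivides g m) ->
  {in gs &, forall g g', mdivides g g' -> g = g'} ->
  min_mon_gen J m <-> m \in gs.
Proof.
move=> JE anti; split=> [[/JE[g gin gm] mmin]|min].
  have [<- //|/eqP ne] := eqVneq g m.
  by case: (mmin g gm ne); apply/JE; exists g.
split=> [|m' dm' ne /JE[g gin dg]]; first by apply/JE; exists m.
have E := anti _ _ gin min (mdivides_trans dg dm').
apply: ne; apply/mnmP => k; apply/eqP; rewrite eqn_leq dm' -{1}E.
exact: dg.
Qed.

(** * The toric ideal and vertex degrees *)

(** The exponent of the image of ['X_[m]]: the vertex degrees of the multigraph in which edge [k]
    has multiplicity [m k]. *)
Definition toric_exp (t : nat) (m : 'X_{1..nE t}) : 'X_{1..nV t} :=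
  (\sum_(k < nE t) (U_((edge_ends k).1) + U_((edge_ends k).2)) *+ m k)%MM.

Lemma toric_mapE (K : comNzRingType) (t : nat) (p : {mpoly K[nE t]}) :
  toric_map p = \sum_(m <- msupp p) p@_m *: 'X_[toric_exp m].
Proof.
rewrite /toric_map /mmap; apply: eq_bigr => m _.
rewrite mul_mpolyC -mprodXnE; congr (_ *: _).
by apply: eq_bigr => k _; rewrite mpolyXD.
Qed.

(** Otherwise the coefficient of ['X_[toric_exp m]] in the image of [f] would be [f@_m] alone, which
    is nonzero. *)
Lemma toric_ideal_cancel (K : comNzRingType) (t : nat) (f : {mpoly K[nE t]}) m :
  toric_ideal f -> m \in msupp f ->
  exists m', [/\ m' \in msupp f, m' != m & toric_exp m' = toric_exp m].
Proof.
rewrite /toric_ideal toric_mapE => f0 mf.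
have : has (fun m' => (m' != m) && (toric_exp m' == toric_exp m)) (msupp f).
  apply/negPn/negP => /hasPn H.
  have := congr1 (mcoeff (toric_exp m)) f0; rewrite raddf_sum mcoeff0 /=.
  rewrite (bigD1_seq m) //= mcoeffZ mcoeffX eqxx mulr1 big_seq_cond big1.
    by rewrite addr0 => /eqP; rewrite mcoeff_eq0 mf.
  move=> m' /andP[/H]; rewrite mcoeffZ mcoeffX; case: eqP => //= _.
  by case: eqP => //; rewrite mulr0.
by case/hasP=> m' m'f /andP[ne /eqP]; exists m'.
Qed.

Lemma toric_ideal_binomial (K : comNzRingType) (t : nat) (m m' : 'X_{1..nE t}) :
  toric_exp m = toric_exp m' -> toric_ideal ('X_[m] - 'X_[m'] : {mpoly K[nE t]}).
Proof.
move=> E; rewrite /toric_ideal /toric_map raddfB /= !mmapX.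
have H m0 : mmap1 (fun k => 'X_((edge_ends k).1) * 'X_((edge_ends k).2)) m0
    = 'X_[toric_exp m0] :> {mpoly K[nV t]}.
  by rewrite -mprodXnE; apply: eq_bigr => k _; rewrite mpolyXD.
by rewrite !H E subrr.
Qed.

Lemma toric_expD (t : nat) (m m' : 'X_{1..nE t}) :
  toric_exp (m + m') = (toric_exp m + toric_exp m')%MM.
Proof.
apply/mnmP => v; rewrite mnmDE !mnm_sumE -big_split; apply: eq_bigr => k _.
by rewrite !mulmnE /= -mulnDr -mnmDE.
Qed.

Lemma toric_expU (t : nat) (k : 'I_(nE t)) :
  toric_exp U_(k) = (U_((edge_ends k).1) + U_((edge_ends k).2))%MM.
Proof.
apply/mnmP => v; rewrite mnm_sumE (bigD1 k) //= big1 ?addn0 => [|l].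
  by rewrite mulmnE mnm1E eqxx muln1.
by rewrite eq_sym mulmnE mnm1E => /negbTE->; rewrite muln0.
Qed.

Lemma inord_eq (n i : nat) (j : 'I_n.+1) :
  (i <= n)%N -> (inord i == j) = (i == j :> nat).
Proof. by move=> ?; rewrite -val_eqE /= inordK. Qed.

Lemma inord_edge_eq (t i : nat) (l : 'I_(nE t)) :
  (i <= 2 * t + 5)%N -> (inord i == l) = (i == l :> nat).
Proof. exact: inord_eq. Qed.

Lemma sum_edges (t : nat) (F : 'I_(nE t) -> nat) :
  (\sum_(k < nE t) F k = \sum_(i < t) F (va t i.+1)
   + (F (vf1 t) + F (vf2 t) + F (vf3 t) + F (ve1 t) + F (ve2 t) + F (ve3 t))
   + \sum_(i < t) F (vb t i.+1))%N.
Proof.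
pose G k := F (inord k).
have -> : (\sum_(k < nE t) F k = \sum_(0 <= k < t + 6 + t) G k)%N.
  rewrite (_ : (t + 6 + t)%N = nE t); last by rewrite /nE; lia.
  by rewrite big_mkord; apply: eq_bigr => k _; rewrite /G inord_val.
rewrite big_mkord !big_split_ord /= !big_ord_recl big_ord0 /G /=.
congr (_ + _ + _)%N.
  rewrite /vf1 /vf2 /vf3 /ve1 /ve2 /ve3 /bump /= !addn0 !addnA !addn1.
  by rewrite ?addnS ?addn0 ?addnA.
by apply: eq_bigr => i _; congr (F (inord _)); lia.
Qed.

Lemma edge_ends_edges (t : nat) :
  (forall i, (i < t)%N -> edge_ends (va t i.+1) = (vx1 t, vy t i.+1)) /\
  (forall i, (i < t)%N -> edge_ends (vb t i.+1) = (vx2 t, vy t i.+1)) /\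
  [/\ edge_ends (vf1 t) = (vx2 t, vw1 t), edge_ends (vf2 t) = (vw1 t, vw2 t)
    & edge_ends (vf3 t) = (vw2 t, vx2 t)] /\
  [/\ edge_ends (ve1 t) = (vx1 t, vz1 t), edge_ends (ve2 t) = (vz1 t, vz2 t)
    & edge_ends (ve3 t) = (vz2 t, vx1 t)].
Proof.
have K k : (k <= 2 * t + 5)%N -> (inord k : 'I_(nE t)) = k :> nat by apply: inordK.
split=> [i it|]; first by rewrite /edge_ends K /= ?it //; lia.
split=> [i it|].
  rewrite /edge_ends K; last lia.
  do ![case: ifP; first lia]; move=> *; congr (_, vy t _); lia.
rewrite /edge_ends !K; try lia.
by split; split; do ![case: ifP; try lia].
Qed.

Lemma toric_expE (t : nat) (m : 'X_{1..nE t}) (v : 'I_(nV t)) :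
  (toric_exp m v = \sum_(i < t) m (va t i.+1) * ((0 == v) + (i.+2 == v))
   + (m (vf1 t) * ((1 == v) + (t + 4 == v))
      + m (vf2 t) * ((t + 4 == v) + (t + 5 == v))
      + m (vf3 t) * ((t + 5 == v) + (1 == v))
      + m (ve1 t) * ((0 == v) + (t + 2 == v))
      + m (ve2 t) * ((t + 2 == v) + (t + 3 == v))
      + m (ve3 t) * ((t + 3 == v) + (0 == v)))
   + \sum_(i < t) m (vb t i.+1) * ((1 == v) + (i.+2 == v)))%N.
Proof.
have [Ea [Eb [[Ef1 Ef2 Ef3] [Ee1 Ee2 Ee3]]]] := edge_ends_edges t.
have W k : (((U_((edge_ends k).1) + U_((edge_ends k).2)) *+ m k)%MM v
    = m k * (((edge_ends k).1 == v) + ((edge_ends k).2 == v)))%N.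
  by rewrite mulmnE mnmDE !mnm1E mulnC.
rewrite mnm_sumE (eq_bigr _ (fun k _ => W k)) sum_edges.
rewrite Ef1 Ef2 Ef3 Ee1 Ee2 Ee3 /vx1 /vx2 /vz1 /vz2 /vw1 /vw2 /=.
rewrite !inord_eq; try lia.
congr (_ + _ + _)%N; apply: eq_bigr => i _; have it := ltn_ord i.
  by rewrite Ea // /vx1 /vy /= !inord_eq //; lia.
by rewrite Eb // /vx2 /vy /= !inord_eq //; lia.
Qed.


Lemma toric_exp_vertices (t : nat) (m : 'X_{1..nE t}) :
  let A := (\sum_(i < t) m (va t i.+1))%N in
  let B := (\sum_(i < t) m (vb t i.+1))%N in
  (forall i, (i < t)%N -> toric_exp m (vy t i.+1) = m (va t i.+1) + m (vb t i.+1))%N /\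
  (toric_exp m (vx1 t) = A + m (ve1 t) + m (ve3 t) /\
   toric_exp m (vx2 t) = B + m (vf1 t) + m (vf3 t))%N /\
  [/\ toric_exp m (vz1 t) = m (ve1 t) + m (ve2 t),
      toric_exp m (vz2 t) = m (ve2 t) + m (ve3 t),
      toric_exp m (vw1 t) = m (vf1 t) + m (vf2 t)
    & toric_exp m (vw2 t) = m (vf2 t) + m (vf3 t)]%N.
Proof.
rewrite /=.
have K v : (v <= t + 5)%N -> (inord v : 'I_(nV t)) = v :> nat by apply: inordK.
(* [S0], [S1] and [S2] evaluate the sums over the a's and b's at a z or w, at a y, and at [x_1] or
   [x_2]. *)
have S0 v e (F : 'I_t -> nat) : (t + 2 <= v)%N -> (e < 2)%N ->
    (\sum_(i < t) F i * ((e == v) + (i.+2 == v)) = 0)%N.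
  move=> ? ?; apply: big1 => i _; have := ltn_ord i => it.
  by rewrite (_ : (_ + _ = 0)%N) ?muln0 //; lia.
have S1 (j : 'I_t) e (F : 'I_t -> nat) : (e < 2)%N ->
    (\sum_(i < t) F i * ((e == j.+2) + (i.+2 == j.+2)) = F j)%N.
  move=> e2; have e0 k : (e == k.+2) = false by lia.
  rewrite (bigD1 j) //= e0 !eqSS eqxx muln1 big1 ?addn0 // => i /negPf.
  by rewrite -val_eqE !eqSS /= => ->; rewrite muln0.
have S2 e c (F : 'I_t -> nat) : (c < 2)%N ->
    (\sum_(i < t) F i * ((e == c) + (i.+2 == c)) = (e == c) * \sum_(i < t) F i)%N.
  move=> c2; rewrite big_distrr; apply: eq_bigr => i _.
  by rewrite mulnC; congr (_ * _)%N; lia.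
have N e c : (e < 2 <= c)%N -> (e == t + c)%N = false by lia.
have N' e c : (e < 2 <= c)%N -> (t + c == e)%N = false by lia.
split=> [i it|].
  rewrite toric_expE K; last by lia.
  have Ni c : (2 <= c)%N -> (t + c == i.+2)%N = false by lia.
  by rewrite !(S1 (Ordinal it)) //= !Ni // !muln0 !addn0.
split.
  by rewrite !toric_expE !K ?S2 ?N' ?mul1n ?mul0n ?addn0 ?muln1 ?muln0 //=; lia.
by rewrite !toric_expE !K ?S0 ?eqn_add2l ?N ?muln0 ?muln1 ?addn0 //=; lia.
Qed.

Lemma ltn_sum_exists (t : nat) (F G : 'I_t -> nat) (j : 'I_t) :
  (\sum_(i < t) F i <= \sum_(i < t) G i)%N -> (G j < F j)%N ->
  exists i, (F i < G i)%N.
Proof.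
move=> le lt; apply/existsP; apply: contraLR le => /existsPn H.
rewrite -ltnNge (bigD1 j) //= [ltnRHS](bigD1 j) //= -addSn leq_add //.
by apply: leq_sum => i _; rewrite leqNgt.
Qed.

Variant edge_spec (t : nat) : 'I_(nE t) -> Prop :=
  | EdgeA i of (i < t)%N : edge_spec (va t i.+1)
  | EdgeF1 : edge_spec (vf1 t)
  | EdgeF2 : edge_spec (vf2 t)
  | EdgeF3 : edge_spec (vf3 t)
  | EdgeE1 : edge_spec (ve1 t)
  | EdgeE2 : edge_spec (ve2 t)
  | EdgeE3 : edge_spec (ve3 t)
  | EdgeB i of (i < t)%N : edge_spec (vb t i.+1).

Lemma edgeP (t : nat) (k : 'I_(nE t)) : edge_spec k.
Proof.
have kle : (k <= 2 * t + 5)%N by rewrite -ltnS; exact: ltn_ord.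
rewrite -[k]inord_val; have [lt|ge] := ltnP k t; first exact: EdgeA.
have [lt|ge6] := ltnP k (t + 6).
  have -> : nat_of_ord k = (t + (k - t))%N by lia.
  have : (k - t < 6)%N by lia.
  case: (k - t)%N => [|[|[|[|[|[|//]]]]]] _; rewrite ?addn0; by constructor.
have -> : nat_of_ord k = (t + 5 + (k - (t + 6)).+1)%N by lia.
by apply: EdgeB; lia.
Qed.

(* Put D = m(e_2) - m'(e_2). The vertex equations give f_1, f_3 the same excess D
   and the a's together the excess 2D. If D > 0 then f_1 f_3 e_2 and two a's divide
   m. Otherwise m and m' last differ at some b_j, where a_j has positive excess;
   as the total a-excess is at most 0, some a_i with i < j has negative excess,
   that is, b_i has positive excess. *)
Lemma smaller_toric_exp (t : nat) (m m' : 'X_{1..nE t}) :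
  toric_exp m = toric_exp m' -> m' != m -> grevlex_le m' m ->
  (exists i j, [/\ (j < i < t)%N, 0 < m (va t i.+1) & 0 < m (vb t j.+1)]%N)
  \/ [/\ 1 < \sum_(i < t) m (va t i.+1), 0 < m (vf1 t), 0 < m (vf3 t)
        & 0 < m (ve2 t)]%N.
Proof.
move=> E ne le.
have [Hy [[Hx1 Hx2] [Hz1 Hz2 Hw1 Hw2]]] := toric_exp_vertices m.
have [Hy' [[Hx1' Hx2'] [Hz1' Hz2' Hw1' Hw2']]] := toric_exp_vertices m'.
rewrite -E in Hy' Hx1' Hx2' Hz1' Hz2' Hw1' Hw2'.
have {Hy Hy'} Hy i (it : (i < t)%N) : (m (va t i.+1) + m (vb t i.+1) =
  m' (va t i.+1) + m' (vb t i.+1))%N by rewrite -Hy // -Hy'.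
have HAB : (\sum_(i < t) m (va t i.+1) + \sum_(i < t) m (vb t i.+1) =
    \sum_(i < t) m' (va t i.+1) + \sum_(i < t) m' (vb t i.+1))%N.
  by rewrite -!big_split; apply: eq_bigr => i _; rewrite /= Hy.
have Hdeg : mdeg m = mdeg m' by rewrite !mdegE !sum_edges; lia.
have [k [lt eq]] : exists k : 'I_(nE t),
    (m k < m' k)%N /\ forall l : 'I_(nE t), (k < l)%N -> m' l = m l.
  case: le => [|[_ [E'|//]]]; first by rewrite Hdeg ltnn.
  by rewrite E' eqxx in ne.
have [ltA|leA] := ltnP (\sum_(i < t) m' (va t i.+1)) (\sum_(i < t) m (va t i.+1)).
  by right; split; lia.
left.
have Kb i : (i < t)%N -> (vb t i.+1 : nat) = (t + 5 + i.+1)%N.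
  by move=> it; rewrite /vb inordK //; lia.
(* A last difference before the b's is impossible: all [b_i] agree, so the equations at the [y_i]
   make all [a_i] agree, and the two triangles, being odd cycles, then fix the e's and f's. *)
have [lt6|ge6] := ltnP k (t + 6).
  have Eb i (it : (i < t)%N) : m' (vb t i.+1) = m (vb t i.+1).
    by apply: eq; rewrite Kb //; lia.
  have Ea i (it : (i < t)%N) : m' (va t i.+1) = m (va t i.+1).
    by have := Hy i it; rewrite Eb //; lia.
  have EA : (\sum_(i < t) m' (va t i.+1) = \sum_(i < t) m (va t i.+1))%N.
    by apply: eq_bigr => i _; rewrite Ea.
  exfalso.
  by move: lt; case: (edgeP k) => [i /Ea->|||||||i /Eb->]; lia.
have [j jt Ek] : exists2 j, (j < t)%N & k = vb t j.+1.
  have := ltn_ord k; rewrite {2}/nE => lek.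
  exists (k - (t + 6))%N; first by lia.
  by apply: val_inj; rewrite /= Kb; lia.
rewrite {}Ek in lt eq.
have ltj : (m' (va t j.+1) < m (va t j.+1))%N by have := Hy j jt; lia.
have [i lti] := ltn_sum_exists (F := fun i : 'I_t => m (va t i.+1))
    (G := fun i : 'I_t => m' (va t i.+1)) (j := Ordinal jt) leA ltj.
have Hi := Hy i (ltn_ord i); exists j, i; split; [|lia|lia].
rewrite jt andbT ltnNge leq_eqVlt; apply/negP => /orP[/eqP ji|ji].
  by rewrite -ji in lti; lia.
by have := eq (vb t i.+1); rewrite !Kb //; lia.
Qed.

(** * Encoding of the generators by codes *)

(* The codes (0, (i, j)), (1, (i, j)) and (2, (i, i)) stand for a_i b_j,
   a_i a_j f_1 f_3 e_2 and a_i^2 f_1 f_3 e_2, with the 1-based indices of [gens]. *)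
Definition code := (nat * (nat * nat))%type.

Definition gen_mon (t : nat) (c : code) : 'X_{1..nE t} :=
  let: (k, (i, j)) := c in
  if k == 0%N then madd (mU (va t i)) (mU (vb t j))
  else madd (madd (mU (va t i)) (mU (va t j))) (mF t).

Definition codes (t : nat) : seq code :=
  [seq (0%N, (i, j)) | i <- rev (iota 2 t.-1), j <- rev (iota 1 i.-1)]
  ++ [seq (1%N, (i, j)) | i <- rev (iota 2 t.-1), j <- rev (iota 1 i.-1)]
  ++ [seq (2%N, (i, i)) | i <- rev (iota 1 t)].

Definition valid_code (t : nat) (c : code) : bool :=
  let: (k, (i, j)) := c in
  [&& 0 < j, i <= t & if k < 2 then j < i else (k == 2) && (i == j)]%N.

Lemma valid_code_kind (t k i j : nat) : valid_code t (k, (i, j)) -> (k <= 2)%N.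
Proof. by move=> /and3P[_ _]; case: ifP; lia. Qed.

(** The order of positions in [codes]. Both indices run downwards since each family starts with its
    smallest monomial. *)
Definition code_lt (c c' : code) : bool :=
  let: (k, (i, j)) := c in let: (k', (i', j')) := c' in
  ((k < k') || (k == k') && ((i' < i) || (i == i') && (j' < j)))%N.

(** Exponents as a function of a natural number, free of [inord], so that [lia] applies. The indices
    [t], [t + 2], [t + 4] are those of f_1, f_3, e_2. *)
Definition code_exp (t : nat) (c : code) (l : nat) : nat :=
  let: (k, (i, j)) := c in
  (if k == 0 then (i.-1 == l) + (t + 5 + j == l)
   else (i.-1 == l) + (j.-1 == l) + ((t == l) + (t + 2 == l) + (t + 4 == l)))%N.

Lemma gensE (t : nat) : gens t = [seq gen_mon t c | c <- codes t].
Proof.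
by rewrite /codes !map_cat !map_allpairs -map_comp.
Qed.

Lemma mem_codes (t : nat) (c : code) : (c \in codes t) = valid_code t c.
Proof.
have E k : (c \in [seq (k, (i, j)) | i <- rev (iota 2 t.-1), j <- rev (iota 1 i.-1)])
    = [&& c.1 == k, 0 < c.2.2, c.2.2 < c.2.1 & c.2.1 <= t]%N.
  apply/allpairsPdep/idP => /= [[i [j []]]|].
    by rewrite !mem_rev !mem_iota => ? ? -> /=; lia.
  case: c => k' [i j] /= /and4P[/eqP-> ? ? ?]; exists i, j.
  by rewrite !mem_rev !mem_iota; split=> //; lia.
have E2 : (c \in [seq (2%N, (i, i)) | i <- rev (iota 1 t)])
    = [&& c.1 == 2, 0 < c.2.2, c.2.2 == c.2.1 & c.2.1 <= t]%N.
  apply/mapP/idP => [[i]|]; first by rewrite mem_rev mem_iota => ? -> /=; lia.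
  case: c {E} => k' [i j] /= /and4P[/eqP-> j0 /eqP ij it]; rewrite ij in j0 *; exists i => //.
  by rewrite mem_rev mem_iota; lia.
rewrite !mem_cat !E E2; case: c {E E2} => k [i j] /=.
by case: ifP; lia.
Qed.

Lemma pairwise_codes (t : nat) : pairwise code_lt (codes t).
Proof.
have P m n : pairwise gtn (rev (iota m n)).
  rewrite -sorted_pairwise; last by move=> x y z /= *; lia.
  by rewrite rev_sorted iota_ltn_sorted.
have E k s : pairwise gtn s ->
    pairwise code_lt [seq (k, (i, j)) | i <- s, j <- rev (iota 1 i.-1)].
  elim: s => //= i s IH /andP[/allP lt ps]; rewrite pairwise_cat IH // andbT.
  apply/andP; split.
    apply/allrelP => c c' /mapP[j _ ->] /allpairsPdep[i' [j' [i's _ ->]]].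
    by have := lt _ i's; rewrite /code_lt /=; lia.
  rewrite pairwise_map; apply: sub_pairwise (P _ _) => j j'.
  by rewrite /code_lt /=; lia.
rewrite !pairwise_cat !E ?P //= pairwise_map.
rewrite (sub_pairwise _ (P _ _)) ?andbT; last by move=> i j; rewrite /code_lt /=; lia.
apply/andP; split; apply/allrelP.
  move=> c c' /allpairsPdep[i [j [_ _ ->]]].
  by rewrite mem_cat => /orP[/allpairsPdep[i' [j' [_ _ ->]]]|/mapP[i' _ ->]].
by move=> c c' /allpairsPdep[i [j [_ _ ->]]] /mapP[i' _ ->].
Qed.

Lemma gen_monE (t : nat) (c : code) (l : 'I_(nE t)) :
  valid_code t c -> gen_mon t c l = code_exp t c l.
Proof.
case: c => k [i j] /= /and3P[j0 it H].
have jt : (j <= t)%N by case: ifP H; lia.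
case: eqP => _; rewrite /madd /mF /mU /va /vb /vf1 /vf3 /ve2 !mnmDE !mnm1E.
  by rewrite !inord_edge_eq //; lia.
by rewrite !inord_edge_eq //; lia.
Qed.

(** * Colon ideals in terms of codes *)

(* The inequalities between exponents hold for arbitrary values of the
   indicators involved; on the indicators themselves lia would split cases. *)
Ltac abstract_bools := do ![move: (nat_of_bool (_ == _)) => ?].

(** The core of linear quotients. The strict inequality makes [x] divide every [m] for which the
    monomial of [c] divides that of [d] times [m]. In each case [x] is an a or b of [c] absent from
    [d], and [c'] pairs it with an a or b of [d]. *)
Lemma colon_step (t : nat) (c d : code) :
  valid_code t c -> valid_code t d -> code_lt c d -> exists x c',
  [/\ x <= 2 * t + 5, code_exp t d x < code_exp t c x, valid_code t c', code_lt c' d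
    & forall l, code_exp t c' l <= code_exp t d l + (x == l)]%N.
Proof.
case: c d => k [p q] [k' [i j]] vc vd lt.
have := valid_code_kind vc; have := valid_code_kind vd; move: vc vd lt; rewrite /code_lt /=.
(* As [code_lt] forces [k <= k'], the bullets treat the kinds (0,0), (0,1), (0,2), (1,1), (1,2),
   (2,2) in this order. *)
case: k => [|[|[|//]]] /=; case: k' => [|[|[|//]]] /= vc vd lt _ _ //;
  try (exfalso; lia).
- have [ip|pi|pi] := ltngtP i p; [|exfalso; lia|subst p].
    by exists p.-1, (0%N, (p, j)); split=> [||||l] /=; last abstract_bools; lia.
  by exists (t + 5 + q)%N, (0%N, (i, q)); split=> [||||l] /=; last abstract_bools; lia.
- have [ip|pi] := ltnP i p.
    by exists p.-1, (1%N, (p, i)); split=> [||||l] /=; last abstract_bools; lia.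
  by exists (t + 5 + q)%N, (0%N, (i, q)); split=> [||||l] /=; last abstract_bools; lia.
- have [ip|pi|pi] := ltngtP i p; last subst p.
  + by exists p.-1, (1%N, (p, i)); split=> [||||l] /=; last abstract_bools; lia.
  + by exists p.-1, (1%N, (i, p)); split=> [||||l] /=; last abstract_bools; lia.
  + by exists (t + 5 + q)%N, (0%N, (i, q)); split=> [||||l] /=; last abstract_bools; lia.
- have [ip|pi|pi] := ltngtP i p; [|exfalso; lia|subst p].
    by exists p.-1, (1%N, (p, i)); split=> [||||l] /=; last abstract_bools; lia.
  by exists q.-1, (1%N, (i, q)); split=> [||||l] /=; last abstract_bools; lia.
- have [ip|pi|pi] := ltngtP i p; last subst p.
  + by exists p.-1, (1%N, (p, i)); split=> [||||l] /=; last abstract_bools; lia.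
  + by exists p.-1, (1%N, (i, p)); split=> [||||l] /=; last abstract_bools; lia.
  + by exists q.-1, (1%N, (i, q)); split=> [||||l] /=; last abstract_bools; lia.
- by exists p.-1, (1%N, (p, i)); split=> [||||l] /=; last abstract_bools; lia.
Qed.

Definition code_supp (t : nat) (c : code) : seq nat :=
  let: (k, (i, j)) := c in
  if k == 0%N then [:: i.-1; t + 5 + j]%N
  else [:: i.-1; j.-1; t; t + 2; t + 4]%N.

Lemma code_exp_gt0 (t : nat) (c : code) (l : nat) : (0 < code_exp t c l)%N = (l \in code_supp t c).
Proof.
case: c => k [i j] /=; case: ifP => _; rewrite !inE ![_ == l]eq_sym;
  by rewrite !addn_gt0 !lt0b -?orbA.
Qed.

(* No colon ideal contains a_i (the top index of the generator), b_t, an e or an f;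
   this leaves 2t - 2 variables. *)
Lemma colon_forbidden (t : nat) (c d : code) (x : nat) :
  valid_code t c -> valid_code t d -> code_lt c d ->
  (forall l, l <= 2 * t + 5 -> code_exp t c l <= code_exp t d l + (x == l))%N ->
  x \notin d.2.1.-1 :: (2 * t + 5)%N :: iota t 6.
Proof.
move=> vc vd lt dv.
have {}dv l : (l \in code_supp t c) && (l <= 2 * t + 5)%N ->
    (l \in code_supp t d) || (x == l).
  rewrite -!code_exp_gt0 => /andP[l0 /dv]; case: (x == l); rewrite ?orbT // orbF addn0.
  exact: leq_trans.
case: c d vc vd lt dv => k [p q] [k' [i j]] vc vd lt dv.
have := valid_code_kind vc; have := valid_code_kind vd.
move: vc vd lt; rewrite /code_lt !inE /=.
(* If [x] were the top a of [d], an e or an f, the a's and b's of [c] would all occur in [d], which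
   no earlier code allows. The variable b_t is excluded because a code of kind 0 has
   [q < p <= t]. *)
have := dv p.-1; have := dv q.-1; have := dv (t + 5 + q)%N; rewrite {dv} /code_supp.
case: k => [|[|[|//]]]; case: k' => [|[|[|//]]] //=; rewrite !inE eqxx /= => Db Dq Dp vc vd lt _ _.
- have Ep : (p == i) || (x == p.-1) by clear Db Dq; lia.
  have Eq : (q == j) || (x == t + 5 + q)%N by clear Dp Dq; lia.
  by clear Db Dq Dp; lia.
- have Eq : (x == t + 5 + q)%N by clear Dp Dq; lia.
  by clear Db Dq Dp; lia.
- have Eq : (x == t + 5 + q)%N by clear Dp Dq; lia.
  by clear Db Dq Dp; lia.
- have Ep : [|| p == i, p == j | x == p.-1] by clear Db Dq; lia.
  have Eq : [|| q == i, q == j | x == q.-1] by clear Db Dp; lia.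
  by clear Db Dq Dp; lia.
- have Ep : (p == i) || (x == p.-1) by clear Db Dq; lia.
  have Eq : (q == i) || (x == q.-1) by clear Db Dp; lia.
  by clear Db Dq Dp; lia.
- have Ep : (p == i) || (x == p.-1) by clear Db Dq; lia.
  by clear Db Dq Dp; lia.
Qed.

(** For i, j < t, the earlier generators a_t a_i f_1 f_3 e_2 and a_t b_j divide a_t^2 f_1 f_3 e_2
    times a_i and b_j respectively. Index [x] below [t] is that of a_(x+1). *)
Lemma colon_allowed (t x : nat) :
  (0 < t)%N -> (x <= 2 * t + 5)%N -> x \notin t.-1 :: (2 * t + 5)%N :: iota t 6 ->
  exists c, [/\ valid_code t c, code_lt c (2, (t, t))
    & forall l, code_exp t c l <= code_exp t (2, (t, t)) l + (x == l)]%N.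
Proof.
rewrite !inE => t0 xt xN; have [lt|ge] := ltnP x t.
  by exists (1%N, (t, x.+1)); split=> [||l] /=; last abstract_bools; lia.
exists (0%N, (t, x - (t + 5)))%N; split=> [||l] /=; try lia.
Qed.

(** * Number of generators and absence of divisibilities *)

Lemma size_codes (t : nat) : (0 < t)%N -> size (codes t) = (t ^ 2)%N.
Proof.
(* Twice a triangular number, to avoid division; it is used with [n = t.-1] for kinds 0 and 1. *)
have E (k n : nat) : (2 * size [seq (k, (i, j)) | i <- rev (iota 2 n), j <- rev (iota 1 i.-1)]
    = n.+1 * n)%N.
  rewrite size_allpairs_dep.
  under eq_map => i do rewrite size_rev size_iota.
  rewrite map_rev sumn_rev; elim: n => // n IH.
  by rewrite -(addn1 n) iotaD map_cat sumn_cat /= mulnDr IH; lia.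
rewrite !size_cat size_map size_rev size_iota => t0.
apply/eqP; rewrite -(eqn_pmul2l (ltn0Sn 1)) !mulnDr !E prednK //.
by rewrite -mulnn; apply/eqP; nia.
Qed.

Lemma codes_antichain (t : nat) (c d : code) :
  valid_code t c -> valid_code t d -> mdivides (gen_mon t c) (gen_mon t d) -> c = d.
Proof.
move=> vc vd dv.
have {}dv l : (l <= 2 * t + 5)%N -> (code_exp t c l <= code_exp t d l)%N.
  by move=> lt; have := dv (inord l); rewrite !gen_monE // inordK.
have sv l : (l \in code_supp t c) && (l <= 2 * t + 5)%N -> l \in code_supp t d.
  by rewrite -!code_exp_gt0 => /andP[l0 /dv]; apply: leq_trans.
case: c d vc vd dv sv => k [p q] [k' [i j]] vc vd dv sv.
have := valid_code_kind vc; have := valid_code_kind vd; move: vc vd (dv p.-1).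
have := sv p.-1; have := sv q.-1; have := sv (t + 5 + q)%N; have := sv t.
rewrite {dv sv} /code_supp.
case: k => [|[|[|//]]]; case: k' => [|[|[|//]]] //=; rewrite !inE eqxx ?orbT /=
  => Dt Db Dq Dp vc vd De _ _.
- have Ep : (p == i) by clear Dt Db Dq De; lia.
  have Eq : (q == j) by clear Dt Dp Dq De; lia.
  by rewrite (eqP Ep) (eqP Eq).
- by clear Dt Dp Dq De; lia.
- by clear Dt Dp Dq De; lia.
- by clear Db Dp Dq De; lia.
- have Ep : (p == i) || (p == j) by clear Dt Db Dq De; lia.
  have Eq : (q == i) || (q == j) by clear Dt Db Dp De; lia.
  by congr (_, (_, _)); clear Dt Db Dp Dq De; lia.
- have Ep : (p == i) || (p == j) by clear Dt Db Dq De; lia.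
  have Eq : (q == i) || (q == j) by clear Dt Db Dp De; lia.
  by clear Dt Db Dp Dq De; lia.
- by clear Db Dp Dq De; lia.
(* Supports do not exclude a_p^2 dividing a_i a_j, so exponents at [p.-1] are compared: as [j < i],
   the right one is at most 1. *)
- have Eij : ((i.-1 == p.-1) + (j.-1 == p.-1) <= 1)%N.
    by clear Dt Db Dp Dq De; lia.
  have Eq : q = p by clear Dt Db Dp Dq De; lia.
  have lep : (p.-1 <= 2 * t + 5)%N by clear Dt Db Dp Dq De; lia.
  have := De lep; rewrite Eq !eqxx.
  by move: Eij; clear; abstract_bools; lia.
- have Ep : (p == i) || (p == j) by clear Dt Db Dq De; lia.
  by congr (_, (_, _)); clear Dt Db Dp Dq De; lia.
Qed.

Lemma code_lt_asym (c d : code) : code_lt c d -> ~~ code_lt d c.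
Proof. by case: c d => [k [i j]] [k' [i' j']]; rewrite /code_lt; lia. Qed.

(** * Colon ideals of the list of generators *)

(** The list is increasing for the asymmetric relation [code_lt], so an earlier position is the same
    as a smaller code. *)
Lemma in_colon_gens (t j : nat) (m : 'X_{1..nE t}) :
  (j < size (codes t))%N ->
  let d := nth (0, (0, 0))%N (codes t) j in
  in_colon (gens t) j m <->
  exists c, [/\ valid_code t c, code_lt c d & mdivides (gen_mon t c) (gen_mon t d + m)%MM].
Proof.
move=> jlt d; rewrite /in_colon gensE.
have N i : (i < size (codes t))%N ->
  nth 0%MM [seq gen_mon t c | c <- codes t] i = gen_mon t (nth (0, (0, 0))%N (codes t) i).
  exact: nth_map.
have P := pairwiseP (0, (0, 0))%N (pairwise_codes t).
rewrite (N j) //; split=> [[i ij]|[c [vc cd dv]]].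
  have il := ltn_trans ij jlt; rewrite N // => dv.
  by eexists; split; [rewrite -mem_codes; apply: mem_nth il | exact: P|].
have cin : c \in codes t by rewrite mem_codes.
exists (index c (codes t)); last by rewrite N ?index_mem // nth_index.
rewrite ltnNge leq_eqVlt; apply/negP => /orP[/eqP E|lt].
  by have := code_lt_asym cd; rewrite /d E nth_index // in cd *; rewrite cd.
have := P _ _ _ _ lt; rewrite nth_index // => H.
by have := code_lt_asym cd; rewrite H // inE index_mem.
Qed.

Lemma mdivides_mon_at (t : nat) (c d : code) (m : 'X_{1..nE t}) (x : nat) :
  valid_code t c -> valid_code t d -> mdivides (gen_mon t c) (gen_mon t d + m)%MM ->
  (x <= 2 * t + 5)%N -> (code_exp t c x <= code_exp t d x + m (inord x))%N.
Proof. by move=> vc vd dv xt; have := dv (inord x); rewrite mnmDE !gen_monE // inordK. Qed.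

Lemma mdivides_mon_var (t : nat) (c d : code) (k : 'I_(nE t)) :
  valid_code t c -> valid_code t d ->
  (forall l, code_exp t c l <= code_exp t d l + (k == l :> nat))%N ->
  mdivides (gen_mon t c) (gen_mon t d + U_(k))%MM.
Proof. by move=> vc vd H l; rewrite mnmDE mnm1E !gen_monE. Qed.

Definition forbidden (t i : nat) : seq 'I_(nE t) :=
  map inord (i.-1 :: (2 * t + 5)%N :: iota t 6).

Lemma mem_forbidden (t i : nat) (x : 'I_(nE t)) : (i <= t)%N ->
  (x \in forbidden t i) = (nat_of_ord x \in i.-1 :: (2 * t + 5)%N :: iota t 6).
Proof.
move=> it; apply/mapP/idP => [[y ys ->]|xs]; last by exists (val x); rewrite ?inord_val.
by rewrite inordK //; move: ys; rewrite !inE; lia.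
Qed.

(** There are 2t + 6 edges, and the eight forbidden ones are distinct. *)
Lemma card_forbidden (t i : nat) : (0 < i <= t)%N ->
  #|~: [set x in forbidden t i]| = (2 * t - 2)%N.
Proof.
move=> it; rewrite cardsCs setCK card_ord cardsE.
have /card_uniqP-> : uniq (forbidden t i).
  rewrite map_inj_in_uniq ?cons_uniq ?iota_uniq ?andbT; first by rewrite !inE; lia.
  move=> x y; rewrite !inE => Hx Hy /(congr1 val) /=.
  by rewrite !inordK //; lia.
by rewrite /= /nE; lia.
Qed.

Lemma colon_gens_subset (t j : nat) (k : 'I_(nE t)) :
  (j < size (codes t))%N -> in_colon (gens t) j U_(k)%MM ->
  k \in ~: [set x in forbidden t (nth (0, (0, 0))%N (codes t) j).2.1].
Proof.
move=> jlt /(in_colon_gens _ jlt)[c [vc cd dv]].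
set d := nth _ _ _ in cd dv *.
have vd : valid_code t d by rewrite -mem_codes mem_nth.
rewrite in_setC in_set mem_forbidden; last by case: (d) vd => [? [? ?]] /and3P[].
apply: (colon_forbidden vc vd cd) => l lt.
have := mdivides_mon_at vc vd dv lt; rewrite mnm1E.
by rewrite [k == _]eq_sym inord_eq // eq_sym.
Qed.

Lemma gens_linear_quotients (K : comNzRingType) (t : nat) : linear_quotients K (gens t).
Proof.
move=> j; rewrite gensE size_map => /andP[_ jlt]; rewrite -gensE.
set d := nth (0, (0, 0))%N (codes t) j.
have vd : valid_code t d by rewrite -mem_codes mem_nth.
(* The variables lying in the colon ideal, as a boolean predicate: [seq_sub] makes the codes a
   finite type to quantify over. *)
pose prior (k : 'I_(nE t)) := [exists c : seq_sub (codes t),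
  code_lt (ssval c) d && (gen_mon t (ssval c) <= gen_mon t d + U_(k))%MM].
have priorP k : prior k <-> in_colon (gens t) j U_(k)%MM.
  rewrite in_colon_gens //; split=> [/existsP[[c cin] /= /andP[cd /mnm_lepP dv]]|].
    by exists c; rewrite -mem_codes.
  move=> [c [vc cd dv]]; apply/existsP.
  rewrite -mem_codes in vc; exists (SeqSub vc); rewrite /= cd /=.
  exact/mnm_lepP.
exists [set k | prior k]; apply/colon_gen_by_varsE => m; split; last first.
  move=> [k]; rewrite inE => /priorP[i ij dv] mk; exists i => //.
  apply: mdivides_trans dv _ => l; rewrite !mnmDE leq_add2l mnm1E.
  by case: eqP => // <-.
move=> /(in_colon_gens _ jlt)[c [vc cd dv]].
have [x [c' [xt lt vc' c'd H]]] := colon_step vc vd cd.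
exists (inord x); last by have := mdivides_mon_at vc vd dv xt; move: lt; clear; lia.
rewrite inE; apply/priorP/in_colon_gens => //; exists c'; split=> //.
by apply: mdivides_mon_var => // l; rewrite inordK.
Qed.

(** * The initial ideal *)

(* The other term of the binomial of the toric ideal with leading term [gen_mon t c]:
   a_j b_i, or e_1 e_3 f_2 b_i b_j. *)
Definition tail_mon (t : nat) (c : code) : 'X_{1..nE t} :=
  let: (k, (i, j)) := c in
  if k == 0%N then madd (mU (va t j)) (mU (vb t i))
  else madd (madd (mU (vb t i)) (mU (vb t j)))
            (madd (madd (mU (ve1 t)) (mU (ve3 t))) (mU (vf2 t))).

(** The two monomials consist of alternate edges of an even closed walk: the 4-cycle through [y_i]
    and [y_j], or the walk around both triangles that passes between them through [y_i] and back
    through [y_j]. *)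
Lemma toric_exp_tail (t : nat) (c : code) :
  valid_code t c -> toric_exp (gen_mon t c) = toric_exp (tail_mon t c).
Proof.
case: c => k [i j] vc.
have [i0 j0 it jt] : [/\ 0 < i, 0 < j, i <= t & j <= t]%N.
  by case/and3P: vc => j0 it; case: ifP => _ H; split=> //; lia.
case: i j i0 j0 it jt {vc} => [|i] [|j] // _ _ it jt.
have [Ea [Eb [[Ef1 Ef2 Ef3] [Ee1 Ee2 Ee3]]]] := edge_ends_edges t.
rewrite /gen_mon /tail_mon /mF /madd /mU; case: ifP => _; rewrite !toric_expD !toric_expU
  ?Ef1 ?Ef2 ?Ef3 ?Ee1 ?Ee2 ?Ee3 !(Ea i, Ea j, Eb i, Eb j) //;
  by apply/mnmP => v; rewrite !mnmDE !mnm1E /=; clear;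
    abstract_bools; lia.
Qed.

Lemma tail_monE (t : nat) (c : code) (l : 'I_(nE t)) : valid_code t c -> (t + 5 < l)%N ->
  tail_mon t c l = ((t + 5 + c.2.1 == l) + ((c.1 != 0) && (t + 5 + c.2.2 == l)))%N.
Proof.
case: c => k [i j] /= /and3P[j0 it H] tl.
have jt : (j <= t)%N by case: ifP H; lia.
case: eqP => _; rewrite /madd /mU /va /vb /ve1 /ve3 /vf2 !mnmDE !mnm1E.
  by rewrite !inord_edge_eq //=; lia.
by rewrite !inord_edge_eq //=; lia.
Qed.

(** The smallest variable in either monomial is b_i, with i the top index, and it occurs in the tail
    only. *)
Lemma gen_mon_lead (t : nat) (c : code) : valid_code t c ->
  tail_mon t c != gen_mon t c /\ grevlex_le (tail_mon t c) (gen_mon t c).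
Proof.
move=> vc; pose b := vb t c.2.1.
have [lt1 lt2 lt3 le] : [/\ c.2.1 <= t, 0 < c.2.1, c.1 == 0 -> c.2.2 < c.2.1
    & c.2.2 <= c.2.1]%N.
  by case: c vc {b} => k [i j] /= /and3P[? ? H]; case: ifP H => *; split; lia.
have bE : b = (t + 5 + c.2.1)%N :> nat by rewrite inordK //; lia.
have mon_b (l : 'I_(nE t)) : (b <= l)%N -> gen_mon t c l = ((c.1 == 0%N) && (t + 5 + c.2.2 == l)%N).
  rewrite gen_monE // bE; case: c vc {b bE} lt1 lt2 lt3 le => k [i j] /= _.
  by case: eqP => _ /= *; lia.
have lt : (gen_mon t c b < tail_mon t c b)%N.
  by rewrite mon_b // tail_monE // bE; lia.
split; first by apply: contraTneq lt => ->; rewrite ltnn.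
right; split.
  case: (c) => k [i j]; rewrite /tail_mon /gen_mon /mF /madd /mU; case: ifP => _;
  by rewrite !mdegD !mdeg1.
right; exists b; split=> [//|l bl].
have tl : (t + 5 + c.2.1 < l)%N by rewrite -bE.
by rewrite (mon_b l (ltnW bl)) tail_monE //; lia.
Qed.

Lemma initial_ideal_gens (K : comNzRingType) (t : nat) (m : 'X_{1..nE t}) :
  initial_ideal (@toric_ideal K t) 'X_[m] <->
  exists2 g, g \in gens t & mdivides g m.
Proof.
pose T m0 := exists2 f : {mpoly K[nE t]}, toric_ideal f & is_lead_mon f m0.
apply: iff_trans (ideal_gen_msupp (T := T) _ _) _ => [q|].
  split=> [[f [m0 [If _ lf ->]]]|[m0 [f If lf] ->]]; first by exists m0 => //; exists f.
  exists f, m0; split=> //; apply: contraTneq (proj1 lf) => ->.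
  by rewrite msupp0.
have -> : (forall m1, m1 \in msupp ('X_[m] : {mpoly K[nE t]}) ->
    exists2 m', T m' & mdivides m' m1) <-> exists2 m', T m' & mdivides m' m.
  rewrite msuppX; split=> [|H m1]; first by apply; rewrite mem_head.
  by rewrite inE => /eqP->.
split=> [[m0 [f If [m0f lead]] dv]|[g]]; last first.
  rewrite gensE => /mapP[c]; rewrite mem_codes => vc -> dv; exists (gen_mon t c) => //.
  have [ne le] := gen_mon_lead vc.
  exists ('X_[gen_mon t c] - 'X_[tail_mon t c]); first exact/toric_ideal_binomial/toric_exp_tail.
  split=> [|m'].
    by rewrite mcoeff_msupp mcoeffB !mcoeffX eqxx (negPf ne) subr0 oner_eq0.
  move/msuppB_le; rewrite mem_cat !msuppX !inE => /orP[]/eqP-> //.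
  by right; split=> //; left.
suff [c vc dc] : exists2 c, valid_code t c & mdivides (gen_mon t c) m0.
  exists (gen_mon t c); first by rewrite gensE map_f // mem_codes.
  exact: mdivides_trans dc dv.
have [m' [m'f ne E]] := toric_ideal_cancel If m0f.
have posE (x : nat) (l : 'I_(nE t)) : (0 < m0 (inord x))%N -> (x == l :> nat) ->
    (0 < m0 l)%N.
  by move=> H /eqP xl; rewrite xl inord_val in H.
have [[i [j [ji ai bj]]]|[A2 f1 f3 e2]] := smaller_toric_exp (esym E) ne (lead _ m'f).
  exists (0, (i.+1, j.+1))%N; first by rewrite /=; lia.
  move=> l; rewrite gen_monE /=; last by lia.
  have := posE _ l ai; have := posE _ l bj; rewrite /=.
  by clear -ji; lia.
have [i Ai] : exists i : 'I_t, (0 < m0 (va t i.+1))%N.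
  apply/existsP; apply: contraLR A2 => /existsPn H.
  by rewrite big1 // => i _; apply/eqP; rewrite -leqn0 leqNgt H.
have it := ltn_ord i.
(* The total a-degree is at least 2: either [a_i] occurs twice, giving kind 2, or another a occurs,
   giving kind 1. *)
have [Ai2|Ai1] := ltnP 1 (m0 (va t i.+1)).
  exists (2, (i.+1, i.+1))%N; first by rewrite /= eqxx; lia.
  move=> l; rewrite gen_monE /= ?eqxx; last by lia.
  have := posE _ l f1; have := posE _ l f3; have := posE _ l e2.
  have : (i == l :> nat) -> (1 < m0 l)%N by move/eqP => il; rewrite /va /= il inord_val in Ai2.
  by clear -it; lia.
have [j ne_ji Aj] : exists2 j : 'I_t, j != i & (0 < m0 (va t j.+1))%N.
  apply/exists_inP; apply: contraLR A2 => /exists_inPn H.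
  rewrite (bigD1 i) //= big1 ?addn0 -?leqNgt // => j ji; apply/eqP.
  by rewrite -leqn0 leqNgt H.
have jt := ltn_ord j.
wlog ji : i j it jt Ai Aj ne_ji {Ai1} / (j < i)%N.
  move=> W; move: (ne_ji); rewrite -val_eqE neq_ltn => /orP[lt|lt].
    exact: (W i j).
  by apply: (W j i) => //; rewrite eq_sym.
exists (1, (i.+1, j.+1))%N; first by rewrite /=; lia.
move=> l; rewrite gen_monE /=; last by lia.
have := posE _ l f1; have := posE _ l f3; have := posE _ l e2.
have := posE _ l Ai; have := posE _ l Aj; rewrite /=.
by clear -ji it; lia.
Qed.

(** * Minimal generators, linear quotients and the maximal number of variables *)

Theorem theorem3p5 (K : closedFieldType) (hK : [pchar K] =i pred0)
  (t : nat) (ht : (2 <= t)%N) :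
  let inI := initial_ideal (@toric_ideal K t) in
  let gs := gens t in
  [/\ uniq gs /\ size gs = (t ^ 2)%N,
      (forall m, min_mon_gen inI m <-> m \in gs),
      linear_quotients K gs,
      (forall j S, (0 < j < size gs)%N -> colon_gen_by_vars K gs j S ->
                   (#|S| <= 2 * t - 2)%N)
    & (exists j S, [/\ (0 < j < size gs)%N, colon_gen_by_vars K gs j S
                     & #|S| = (2 * t - 2)%N])].
Proof.
move=> inI gs; have t0 : (0 < t)%N by apply: ltnW.
have sz : size gs = size (codes t) by rewrite /gs gensE size_map.
have dE j : (j < size gs)%N -> valid_code t (nth (0, (0, 0))%N (codes t) j).
  by rewrite sz -mem_codes => ?; apply: mem_nth.
have d1 (d : code) : valid_code t d -> (0 < d.2.1 <= t)%N.
  by case: d => k [i j] /= /and3P[? ?]; case: ifP => ? ?; lia.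
have anti : {in gs &, forall g g', mdivides g g' -> g = g'}.
  move=> g g'; rewrite /gs gensE => /mapP[c cin ->] /mapP[d din ->] dv.
  by rewrite (codes_antichain _ _ dv) // -mem_codes.
have uc : uniq (codes t).
  apply: (pairwise_uniq _ (pairwise_codes t)) => c.
  by apply/negP => cc; have := code_lt_asym cc; rewrite cc.
split.
- split; last by rewrite sz size_codes.
  rewrite /gs gensE map_inj_in_uniq // => c d cin din E.
  by apply: (@codes_antichain t); rewrite -?mem_codes // E => l.
- by move=> m; apply: min_mon_gen_antichain anti => m0; apply: initial_ideal_gens.
- exact: gens_linear_quotients.
- move=> j S /andP[_ jlt] HS.
  have := d1 _ (dE j jlt); set d := nth _ _ _ => di.
  rewrite -(card_forbidden di); apply: subset_leq_card; apply/subsetP => k.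
  by move/(colon_gen_by_vars_mem k HS); apply: colon_gens_subset; rewrite -sz.
(* The bound is attained at a_t^2 f_1 f_3 e_2. *)
have din : (2, (t, t))%N \in codes t by rewrite mem_codes /= eqxx; lia.
pose j := index (2, (t, t))%N (codes t).
have jlt : (j < size gs)%N by rewrite sz index_mem.
have j0 : (0 < j)%N.
  rewrite lt0n; apply/eqP => jE.
  (* The generator a_2 b_1 exists since [t >= 2]; were a_t^2 f_1 f_3 e_2 first in the list, a_2 b_1
     would equal it or come after it. *)
  have cin : (0, (2, 1))%N \in codes t by rewrite mem_codes /=; lia.
  have := pairwiseP (0, (0, 0))%N (pairwise_codes t) j (index (0, (2, 1))%N (codes t)).
  rewrite !inE !index_mem din cin !nth_index // => /(_ isT isT); rewrite jE lt0n.
  case: eqP => [E _|_ /(_ isT) //].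
  have : (0, (2, 1))%N = (2, (t, t))%N; last by [].
  by rewrite -(nth_index (0, (0, 0))%N cin) E -[RHS](nth_index (0, (0, 0))%N din) -/j jE.
have [S HS] := gens_linear_quotients K (t := t) (j := j) (introT andP (conj j0 jlt)).
exists j, S; split; [by rewrite j0|by []|].
rewrite -(card_forbidden (t := t) (i := t)); last by rewrite t0 leqnn.
apply/eq_card => k; apply/idP/idP.
  move/(colon_gen_by_vars_mem k HS)/colon_gens_subset; rewrite -sz => /(_ jlt).
  by rewrite nth_index.
rewrite in_setC in_set mem_forbidden // => kN.
apply/(colon_gen_by_vars_mem k HS)/in_colon_gens; rewrite -?sz // nth_index //.
have [c [vc cd H]] := colon_allowed t0 (ltn_ord k : (k <= 2 * t + 5)%N) kN.
exists c; split=> //; apply: mdivides_mon_var => //.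
by rewrite -mem_codes.
Qed.
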